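(* There exist an integer $n\ge 2$ and a cocompact lattice $\Gamma$ in $\mathrm{Isom}(\mathrm{DL}(n,n))$ such that no finite index subgroup of $\Gamma$ is isomorphic to a lamplighter group. Moreover, the class of discrete groups that are commensurable to lamplighter groups is not closed under quasi-isometries: there exist finitely generated groups $\Gamma_1,\Gamma_2$ that are quasi-isometric to each other, such that $\Gamma_1$ is commensurable to a lamplighter group and $\Gamma_2$ is not commensurable to any lamplighter group.
   Context: A lamplighter group is a group of the form $F\wr\mathbf{Z}=\left(\bigoplus_{\mathbf{Z}}F\right)\rtimes\mathbf{Z}$ with $F$ a finite group, where $\mathbf{Z}$ acts by shifting coordinates. Two groups are commensurable if they have isomorphic subgroups of finite index. For an integer $n\ge 2$, $T_n$ is the $(n+1)$-regular tree with a fixed end $-\infty$. For vertices $x,y$, let $\widehat{xy}$ be the vertex at which the rays from $x$ and from $y$ to $-\infty$ merge. With a base vertex $o$, the Busemann function is $b(x)=d(x,\widehat{xo})-d(o,\widehat{xo})\in\mathbf{Z}$. The Diestel-Leader graph $\mathrm{DL}(n,n)$ has vertex set $\{(x,y)\in T_n\times T_n: b(x)+b(y)=0\}$ (pairs of vertices), with $(x,y)$ and $(x',y')$ joined by an edge iff both $\{x,x'\}$ and $\{y,y'\}$ are edges of $T_n$. It is a connected, locally finite graph. Its isometry group $\mathrm{Isom}(\mathrm{DL}(n,n))$ (graph automorphisms) has the topology of pointwise convergence on vertices and is locally compact; a cocompact lattice in it is a discrete cocompact subgroup, i.e. a subgroup with finite vertex stabilizers and finitely many vertex orbits. *)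

(* Defs.v *)
From HB Require Import structures.
From mathcomp Require Import all_boot all_order all_algebra all_fingroup.
From mathcomp Require Import finmap zify ring lra.
From mathcomp Require Import boolp classical_sets functions cardinality.

Set Implicit Arguments.
Unset Strict Implicit.
Unset Printing Implicit Defensive.

Import Order.TTheory GRing.Theory Num.Theory.

Local Open Scope classical_set_scope.

Section Graphs.
Variables (V : choiceType) (e : rel V).

Definition walk_length (x y : V) (k : nat) : Prop :=
  exists p : seq V, [/\ path e x p, last x p = y & size p = k].

Definition connected_graph : Prop := forall x y, exists k, walk_length x y k.

Lemma walk_sym x y k : symmetric e ->
  walk_length x y k -> walk_length y x k.
Proof.
move=> se [p [ep <- <-]]; exists (rev (belast x p)); split.
- by rewrite rev_path; move: ep; apply: sub_path => u v; rewrite se.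
- by case: p ep => [|z p] //= _; rewrite rev_cons last_rcons.
- by rewrite size_rev size_belast.
Qed.

(* Graph distance; 0 by convention if x and y are not connected. *)
Definition dist (x y : V) : nat :=
  if pselect (exists k, `[< walk_length x y k >]) is left ex then ex_minn ex
  else 0%N.

Definition is_tree : Prop :=
  [/\ symmetric e, irreflexive e, connected_graph
    & forall c : seq V, (2 < size c)%N -> ~ ucycle e c].

Definition regular_graph (d : nat) : Prop :=
  forall x, exists s : seq V, [/\ uniq s, size s = d & s =i e x].

Definition is_ray (r : nat -> V) : Prop :=
  injective r /\ forall k, e (r k) (r k.+1).

Definition same_end (r s : nat -> V) : Prop :=
  exists i j, forall k, r (i + k)%N = s (j + k)%N.

Definition is_graph_aut (f : V -> V) : bool :=
  `[< bijective f /\ forall x y, e (f x) (f y) = e x y >].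

Definition graph_aut : Type := {f : V -> V | is_graph_aut f}.
HB.instance Definition _ := Choice.copy graph_aut {f : V -> V | is_graph_aut f}.

Definition aut_fun (f : graph_aut) : V -> V := val f.
Coercion aut_fun : graph_aut >-> Funclass.

Lemma graph_autP (f g : graph_aut) : aut_fun f =1 aut_fun g -> f = g.
Proof. by move=> fg; apply/val_inj/funext. Qed.

Fact aut_one_subproof : is_graph_aut id.
Proof. by apply/asboolP; split=> //; exists id. Qed.
Definition aut_one : graph_aut := Sub id aut_one_subproof.

Fact aut_mul_subproof (f g : graph_aut) : is_graph_aut (f \o g).
Proof.
have /asboolP[bf ef] := valP f; have /asboolP[bg eg] := valP g.
by apply/asboolP; split=> [|x y /=]; [exact: bij_comp | rewrite ef eg].
Qed.
Definition aut_mul (f g : graph_aut) : graph_aut :=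
  Sub (f \o g) (aut_mul_subproof f g).

Fact aut_inv_exists (f : graph_aut) :
  exists g : graph_aut,
    cancel (aut_fun f) (aut_fun g) /\ cancel (aut_fun g) (aut_fun f).
Proof.
have /asboolP[[g fg gf] ef] := valP f.
suff Pg : is_graph_aut g by exists (Sub g Pg).
by apply/asboolP; split=> [|x y]; [exists (val f) | rewrite -ef !gf].
Qed.
Definition aut_inv (f : graph_aut) : graph_aut := projT1 (cid (aut_inv_exists f)).

Lemma aut_invK f : cancel (aut_fun f) (aut_fun (aut_inv f)).
Proof. by rewrite /aut_inv; case: cid => g []. Qed.
Lemma aut_invKr f : cancel (aut_fun (aut_inv f)) (aut_fun f).
Proof. by rewrite /aut_inv; case: cid => g []. Qed.

Fact aut_mulA : associative aut_mul.
Proof. by move=> f g h; apply: graph_autP. Qed.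
Fact aut_mul1 : left_id aut_one aut_mul.
Proof. by move=> f; apply: graph_autP. Qed.
Fact aut_1mul : right_id aut_one aut_mul.
Proof. by move=> f; apply: graph_autP. Qed.
Fact aut_mulV : left_inverse aut_one aut_inv aut_mul.
Proof. by move=> f; apply: graph_autP => x; apply: aut_invK. Qed.
Fact aut_Vmul : right_inverse aut_one aut_inv aut_mul.
Proof. by move=> f; apply: graph_autP => x; apply: aut_invKr. Qed.

HB.instance Definition _ :=
  isGroup.Build graph_aut aut_mulA aut_mul1 aut_1mul aut_mulV aut_Vmul.

End Graphs.

Section Subgroups.
Variable G : groupType.
Local Open Scope group_scope.

Definition is_subgroup (H : set G) : Prop := group_closed [in H].

Definition finite_index_subgroup (K H : set G) : Prop :=
  [/\ is_subgroup K, K `<=` H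
    & finite_set [set [set x * k | k in K] | x in H]].

Definition generates (S : seq G) : Prop :=
  forall H : set G, is_subgroup H -> {subset S <= H} -> H = [set: G].

Definition finitely_generated : Prop := exists S : seq G, generates S.

Definition cayley (S : seq G) : rel G :=
  fun x y => (x^-1 * y \in S) || (y^-1 * x \in S).

Definition word_metric (S : seq G) : G -> G -> nat := dist (cayley S).

End Subgroups.

Definition isomorphic_subgroups (G G' : groupType) (H : set G) (K : set G') :
  Prop :=
  exists f : G -> G',
    {in H &, {morph f : x y / (x * y)%g}} /\ set_bij H K f.

Definition commensurable (G G' : groupType) : Prop :=
  exists (H : set G) (K : set G'),
    [/\ finite_index_subgroup H [set: G], finite_index_subgroup K [set: G']
      & isomorphic_subgroups H K].

Section QuasiIsometry.
Local Open Scope ring_scope.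

Definition is_quasi_isometry (X Y : Type) (dX : X -> X -> nat)
    (dY : Y -> Y -> nat) (f : X -> Y) : Prop :=
  exists L C : rat,
    [/\ 1 <= L, 0 <= C,
      forall x x', (dX x x')%:R / L - C <= (dY (f x) (f x'))%:R
                     <= L * (dX x x')%:R + C
      & forall y, exists x, (dY (f x) y)%:R <= C].

(* The word metrics of any two finite generating sets of a group are
   bilipschitz equivalent, so the choice of S and S' is immaterial. *)
Definition quasi_isometric (G G' : groupType) : Prop :=
  exists (S : seq G) (S' : seq G') (f : G -> G'),
    [/\ generates S, generates S'
      & is_quasi_isometry (word_metric S) (word_metric S') f].

End QuasiIsometry.

Section Lamplighter.
Variable F : finGroupType.

Definition lamplighter : Type := ({fsfun int -> F with 1%g} * int)%type.
HB.instance Definition _ :=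
  Choice.copy lamplighter ({fsfun int -> F with 1%g} * int)%type.

Implicit Types x y z : lamplighter.

Local Open Scope fset_scope.
Local Open Scope ring_scope.

(* (a, k) (b, l) = (a * (k . b), k + l) with (k . b) i = b (i - k). *)
Definition lamp_mul x y : lamplighter :=
  ([fsfun i in finsupp x.1 `|` [fset (j + x.2)%R | j in finsupp y.1] =>
      (x.1 i * y.1 (i - x.2)%R)%g], x.2 + y.2).

Definition lamp_one : lamplighter := ([fsfun], 0).

Definition lamp_inv x : lamplighter :=
  ([fsfun i in [fset (j - x.2)%R | j in finsupp x.1] => (x.1 (i + x.2)%R)^-1%g],
   - x.2).

Lemma lamp_mulE x y i : (lamp_mul x y).1 i = (x.1 i * y.1 (i - x.2))%g.
Proof.
rewrite fsfun_fun; case: ifPn => //; rewrite in_fsetU negb_or => /andP[xi yi].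
rewrite (fsfun_dflt xi) mul1g fsfun_dflt //; apply: contra yi => yi.
by apply/imfsetP; exists (i - x.2) => //=; rewrite subrK.
Qed.

Lemma lamp_oneE i : lamp_one.1 i = 1%g.
Proof. by rewrite fsfun0E. Qed.

Lemma lamp_invE x i : (lamp_inv x).1 i = (x.1 (i + x.2))^-1%g.
Proof.
rewrite fsfun_fun; case: ifPn => // xi; rewrite fsfun_dflt ?invg1 //.
by apply: contra xi => xi; apply/imfsetP; exists (i + x.2) => //=; rewrite addrK.
Qed.

Lemma lampP x y : x.1 =1 y.1 -> x.2 = y.2 -> x = y.
Proof. by case: x y => [a k] [b l] /= /fsfunP -> ->. Qed.

Fact lamp_mulA : associative lamp_mul.
Proof.
move=> x y z; apply: lampP => [i|]; last exact: addrA.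
by rewrite !lamp_mulE mulgA opprD addrA.
Qed.
Fact lamp_mul1 : left_id lamp_one lamp_mul.
Proof.
move=> x; apply: lampP => [i|]; last exact: add0r.
by rewrite [LHS]lamp_mulE lamp_oneE mul1g subr0.
Qed.
Fact lamp_1mul : right_id lamp_one lamp_mul.
Proof.
move=> x; apply: lampP => [i|]; last exact: addr0.
by rewrite lamp_mulE lamp_oneE mulg1.
Qed.
Fact lamp_mulV : left_inverse lamp_one lamp_inv lamp_mul.
Proof.
move=> x; apply: lampP => [i|]; last exact: addNr.
by rewrite lamp_mulE lamp_oneE lamp_invE opprK mulVg.
Qed.
Fact lamp_Vmul : right_inverse lamp_one lamp_inv lamp_mul.
Proof.
move=> x; apply: lampP => [i|]; last exact: addrN.
by rewrite lamp_mulE lamp_oneE lamp_invE subrK mulgV.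
Qed.

HB.instance Definition _ :=
  isGroup.Build lamplighter lamp_mulA lamp_mul1 lamp_1mul lamp_mulV lamp_Vmul.

End Lamplighter.

Section Tree.
Variable n : nat.
Local Open Scope fset_scope.
Local Open Scope ring_scope.

(* A vertex is a pair (k, w): k is the height, and the finitely supported word
   w lists the labels of the edges met on the way from the vertex to the end
   -oo, so that dropping the first letter of w gives the neighbour towards -oo.
   This is meant for n >= 2 only, in which case #|'Z_n| = n. *)
Definition tree : Type := (int * {fsfun nat -> 'Z_n with (0 : 'Z_n)})%type.
HB.instance Definition _ :=
  Choice.copy tree (int * {fsfun nat -> 'Z_n with (0 : 'Z_n)})%type.

Implicit Types x y z : tree.

Definition parent x : tree :=
  (x.1 - 1, [fsfun j in [fset i.-1 | i in finsupp x.2] => x.2 j.+1]).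

Definition tree_adj : rel tree :=
  fun x y => (y == parent x) || (x == parent y).

Definition ray_to_end x : nat -> tree := fun k => iter k parent x.

Definition base : tree := (0, [fsfun]).

Lemma parentE x j : (parent x).2 j = x.2 j.+1.
Proof.
rewrite fsfun_fun; case: ifPn => // xj; rewrite fsfun_dflt //.
by apply: contra xj => xj; apply/imfsetP; exists j.+1.
Qed.

Lemma treeP x y : x.1 = y.1 -> x.2 =1 y.2 -> x = y.
Proof. by case: x y => [k a] [l b] /= -> /fsfunP ->. Qed.

Lemma ray_to_end_height x k : (ray_to_end x k).1 = x.1 - k%:Z.
Proof.
elim: k => [|k IH]; first by rewrite subr0.
by rewrite /ray_to_end iterS /= -/(ray_to_end x k) IH; lia.
Qed.

Lemma ray_to_end_word x k j : (ray_to_end x k).2 j = x.2 (k + j)%N.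
Proof.
elim: k j => [|k IH] j //.
by rewrite /ray_to_end iterS parentE -/(ray_to_end x k) IH addSnnS.
Qed.

Lemma word_bounded x : exists N, forall j, (N <= j)%N -> x.2 j = 0.
Proof.
exists (\sum_(i <- finsupp x.2) i.+1)%N => j le_j; apply: fsfun_dflt.
apply/negP => xj; move: le_j; rewrite (big_rem j) //=.
by move=> H; have := leq_trans (leq_addr _ _) H; rewrite ltnn.
Qed.

Lemma ray_to_end_same_end x y : same_end (ray_to_end x) (ray_to_end y).
Proof.
have [M xM] := word_bounded x; have [N yN] := word_bounded y.
pose z := (absz x.1 + absz y.1)%N.
exists (M + N + absz (x.1 + z%:Z)%R)%N, (M + N + absz (y.1 + z%:Z)%R)%N => k.
apply: treeP => [|j]; first by rewrite !ray_to_end_height; lia.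
by rewrite !ray_to_end_word xM ?yN //; lia.
Qed.

Lemma rays_meet x y :
  exists k, `[< exists j, ray_to_end x k = ray_to_end y j >].
Proof.
have [i [j ij]] := ray_to_end_same_end x y.
by exists i; apply/asboolP; exists j; have := ij 0%N; rewrite !addn0.
Qed.

(* The first vertex of the ray from x that lies on the ray from y. *)
Definition merge x y : tree := ray_to_end x (ex_minn (rays_meet x y)).

Definition busemann x : int :=
  (dist tree_adj x (merge x base))%:Z - (dist tree_adj base (merge x base))%:Z.

Lemma tree_adj_sym : symmetric tree_adj.
Proof. by move=> x y; rewrite /tree_adj orbC. Qed.

Lemma tree_adj_irr : irreflexive tree_adj.
Proof. by move=> x; apply/norP; split; apply/eqP => /(congr1 fst) /=; lia. Qed.

Lemma ray_to_end_is_ray x : is_ray tree_adj (ray_to_end x).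
Proof.
split=> [i j /(congr1 fst)|k]; first by rewrite !ray_to_end_height; lia.
by rewrite /tree_adj /ray_to_end iterS eqxx.
Qed.

Lemma walk_to_ray x k : walk_length tree_adj x (ray_to_end x k) k.
Proof.
exists (traject parent (parent x) k); split; last exact: size_traject.
- apply: (@sub_path _ (frel parent)); last exact: fpath_traject.
  by move=> y z /= /eqP <-; rewrite /tree_adj eqxx.
- by rewrite last_traject.
Qed.

Lemma tree_connected : connected_graph tree_adj.
Proof.
move=> x y; have [i [j ij]] := ray_to_end_same_end x y.
have [p [ep lp _]] := walk_to_ray x i.
have [q [eq lq _]] := walk_sym tree_adj_sym (walk_to_ray y j).
exists (size (p ++ q)), (p ++ q); split=> //.
- by rewrite cat_path ep lp; have := ij 0%N; rewrite !addn0 => ->.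
- by rewrite last_cat lp; have := ij 0%N; rewrite !addn0 => ->.
Qed.

Lemma max_height x (c : seq tree) :
  exists2 y, y \in x :: c & forall z, z \in x :: c -> z.1 <= y.1.
Proof.
elim: c x => [|x c IH] y.
  by exists y; [rewrite inE | move=> z; rewrite inE => /eqP ->].
have [z zc zmax] := IH x; have [le_zy|/ltW le_yz] := lerP z.1 y.1.
  exists y; rewrite ?mem_head // => t; rewrite inE => /orP[/eqP -> //|/zmax].
  by move/le_trans; apply.
exists z => [|t]; first by rewrite inE zc orbT.
by rewrite inE => /orP[/eqP -> //|/zmax].
Qed.

Lemma tree_acyclic (c : seq tree) : (2 < size c)%N -> ~ ucycle tree_adj c.
Proof.
move=> c_gt2 /andP[cyc_c uniq_c].
have [x xc xmax] : exists2 x, x \in c & forall y, y \in c -> y.1 <= x.1.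
  by case: c c_gt2 {cyc_c uniq_c} => // a c _; exact: max_height.
have up y : y \in c -> tree_adj x y -> y = parent x.
  move=> yc /orP[/eqP//|/eqP xE]; have := xmax _ yc.
  by rewrite xE /=; lia.
have [i c' def_c] := rot_to xc.
have cyc : path.cycle tree_adj (x :: c') by rewrite -def_c rot_cycle.
have unq : uniq (x :: c') by rewrite -def_c rot_uniq.
have mm y : y \in x :: c' -> y \in c by rewrite -def_c mem_rot.
have sz : (2 < size (x :: c'))%N by rewrite -def_c size_rot.
case: c' {def_c} cyc unq mm sz => [|y c'] //= cyc unq mm sz.
case/lastP: c' cyc unq mm sz => [|c' z] // cyc unq mm _.
move: cyc; rewrite rcons_path last_rcons => /and3P[xy _ zx].
have yE : y = parent x by apply: up xy; apply: mm; rewrite !inE eqxx orbT.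
have zE : z = parent x.
  by apply: up; [apply: mm; rewrite !(inE, mem_rcons) eqxx !orbT
                |rewrite tree_adj_sym].
move: unq; rewrite yE zE => /and3P[_].
by rewrite mem_rcons inE eqxx.
Qed.

Lemma tree_is_tree : is_tree tree_adj.
Proof.
split; [exact: tree_adj_sym | exact: tree_adj_irr | exact: tree_connected |].
exact: tree_acyclic.
Qed.

Definition child x (c : 'Z_n) : tree :=
  (x.1 + 1, [fsfun j in 0%N |` [fset i.+1 | i in finsupp x.2] =>
               if j is i.+1 then x.2 i else c]).

Lemma childE x c j : (child x c).2 j = if j is i.+1 then x.2 i else c.
Proof.
rewrite fsfun_fun; case: ifPn => //; rewrite in_fsetU in_fset1.
case: j => [|j] //= xj; rewrite fsfun_dflt //.
by apply: contra xj => xj; apply/imfsetP; exists j.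
Qed.

Lemma childK x c : parent (child x c) = x.
Proof.
by apply: treeP => [|j]; [rewrite /= addrK | rewrite parentE childE].
Qed.

Lemma parentK x : child (parent x) (x.2 0%N) = x.
Proof.
apply: treeP => [|j]; first by rewrite /= subrK.
by rewrite childE; case: j => // j; rewrite parentE.
Qed.

Lemma child_inj x : injective (child x).
Proof.
by move=> c d /(congr1 (fun z : tree => z.2 0%N)); rewrite !childE.
Qed.

Lemma tree_regular : (1 < n)%N -> regular_graph tree_adj n.+1.
Proof.
move=> n_gt1 x; exists (parent x :: [seq child x c | c : 'Z_n]); split.
- rewrite /= map_inj_uniq ?enum_uniq ?andbT; last exact: child_inj.
  by apply/negP => /mapP[c _ /(congr1 fst)] /=; lia.
- by rewrite /= size_map -cardE card_ord Zp_cast.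
- move=> y; rewrite inE unfold_in; congr (_ || _).
  apply/mapP/eqP => [[c _ ->]|->]; first by rewrite childK.
  by exists (y.2 0%N); rewrite ?mem_enum ?parentK.
Qed.

Lemma walk_height x y k :
  walk_length tree_adj x y k -> `|x.1 - y.1| <= k%:Z.
Proof.
case=> p [+ <- <-]; elim: p x => [|z p IH] x /=; first by rewrite subrr.
case/andP=> xz /IH; case/orP: xz => /eqP -> /=; lia.
Qed.

Lemma dist_ray x k : dist tree_adj x (ray_to_end x k) = k.
Proof.
rewrite /dist; case: pselect => [ex|[]]; last first.
  by exists k; apply/asboolP/walk_to_ray.
case: ex_minnP => m /asboolP/walk_height; rewrite ray_to_end_height => km.
by move=> /(_ k (asboolT (walk_to_ray x k))); lia.
Qed.

Lemma dist_ray_sym x k : dist tree_adj (ray_to_end x k) x = k.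
Proof.
have w : walk_length tree_adj (ray_to_end x k) x k.
  exact: walk_sym tree_adj_sym (walk_to_ray x k).
rewrite /dist; case: pselect => [ex|[]]; last by exists k; apply/asboolP.
case: ex_minnP => m /asboolP/walk_height; rewrite ray_to_end_height => km.
by move=> /(_ k (asboolT w)); lia.
Qed.

Lemma busemann_height x : busemann x = x.1.
Proof.
rewrite /busemann /merge; case: ex_minnP => k /asboolP[j kj] _.
rewrite dist_ray kj dist_ray.
by have := congr1 fst kj; rewrite !ray_to_end_height /=; lia.
Qed.

End Tree.

Section DiestelLeader.
Variable n : nat.

Definition DL_vertex : Type :=
  {p : tree n * tree n | (busemann p.1 + busemann p.2 == 0)%R}.
HB.instance Definition _ := Choice.copy DL_vertex
  {p : tree n * tree n | (busemann p.1 + busemann p.2 == 0)%R}.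

Definition DL_adj : rel DL_vertex := fun u v =>
  tree_adj (val u).1 (val v).1 && tree_adj (val u).2 (val v).2.

End DiestelLeader.

Notation IsomDL n := (graph_aut (@DL_adj n)).

(* DL(n,n) is locally finite and vertex-transitive, so for the topology of
   pointwise convergence a subgroup of its isometry group is discrete iff its
   vertex stabilizers are finite, and is then cocompact iff it has finitely many
   vertex orbits. *)
Definition cocompact_lattice (n : nat) (Gam : set (IsomDL n)) : Prop :=
  [/\ is_subgroup Gam,
      forall u : DL_vertex n, finite_set [set g | Gam g /\ g u = u]
    & finite_set [set [set g u | g in Gam] | u in [set: DL_vertex n]]].

(* Main.v *)
Require Import Defs.
From HB Require Import structures.
From mathcomp Require Import all_boot all_order all_algebra all_fingroup.
From mathcomp Require Import cyclic finmap zify.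
From mathcomp Require Import boolp classical_sets functions cardinality.

(** Cross the wires of the lamplighter group over (Z/2)^2 with lamp generators
    x_i, z_i: let the z_i stay central and set [x_i, x_j] = z_((i + j) / 2)
    whenever i <> j have the same parity.  As (i + j) / 2 lies between i and j,
    lamps in an interval still form a finite subgroup, every base element is a
    product of lamps in increasing order and also in decreasing order, and the
    Cayley graph for the generators "change the lamp at the cursor, then move
    up" remains DL(4, 4), which is also that of the lamplighter group over Z/4.
    Hence the crosswired group is quasi-isometric to a lamplighter group, and is
    a lattice acting simply transitively on DL(4, 4).

    In a lamplighter group a torsion element commutes with its conjugates by all
    high powers of any element of infinite order.  In the crosswired group this
    fails in every finite index subgroup, because arbitrarily distant x_i and
    x_j do not commute; hence no finite index subgroup embeds in a lamplighter
    group. *)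

Set Implicit Arguments.
Unset Strict Implicit.
Unset Printing Implicit Defensive.

Import Order.TTheory GRing.Theory Num.Theory.

Local Open Scope classical_set_scope.

(** * Graph isomorphisms: walks, distances and connectedness *)

Section GraphIsomorphisms.
Variables (V W : choiceType) (e : rel V) (e' : rel W).

Definition graph_iso (f : V -> W) : Prop :=
  bijective f /\ forall x y, e' (f x) (f y) = e x y.

Lemma graph_iso_walk (f : V -> W) x y k : graph_iso f ->
  walk_length e' (f x) (f y) k <-> walk_length e x y k.
Proof.
move=> [[g fK gK] fe]; split=> [] [p [ep lp <-]].
  exists (map g p); split; last exact: size_map.
    move: ep; rewrite -[f x](congr1 f (fK x)) -{1}(mapK gK p).
    by rewrite fK path_map; apply: sub_path => u v /=; rewrite fe.
  by rewrite -(fK x) last_map lp fK.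
exists (map f p); split; last exact: size_map.
  by rewrite path_map; move: ep; apply: sub_path => u v /=; rewrite fe.
by rewrite last_map lp.
Qed.

Lemma graph_iso_dist (f : V -> W) x y : graph_iso f ->
  dist e' (f x) (f y) = dist e x y.
Proof.
move=> fiso; have w k := graph_iso_walk x y k fiso.
rewrite /dist; case: pselect => [ex|nex]; case: pselect => [ex'|nex'] //.
- case: ex_minnP => m /asboolP/w wm min_m; case: ex_minnP => n /asboolP wn min_n.
  apply/eqP; rewrite eqn_leq min_n ?min_m //; first by apply/asboolP/w.
  exact/asboolP.
- by case: nex'; case: ex => k /asboolP/w ?; exists k; apply/asboolP.
- by case: nex; case: ex' => k /asboolP ?; exists k; apply/asboolP/w.
Qed.

Lemma graph_iso_connected (f : V -> W) :
  graph_iso f -> connected_graph e' -> connected_graph e.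
Proof.
move=> fiso ce x y.
by have [k /(graph_iso_walk _ _ _ fiso)] := ce (f x) (f y); exists k.
Qed.

End GraphIsomorphisms.

Lemma graph_iso_comp (U V W : choiceType) (e : rel U) (e' : rel V) (e'' : rel W)
    (f : U -> V) (g : V -> W) :
  graph_iso e e' f -> graph_iso e' e'' g -> graph_iso e e'' (g \o f).
Proof.
move=> [bf ef] [bg eg]; split; first exact: bij_comp.
by move=> x y /=; rewrite eg ef.
Qed.

Lemma graph_iso_inv (V W : choiceType) (e : rel V) (e' : rel W) (f : V -> W) :
  graph_iso e e' f -> exists g : W -> V, graph_iso e' e g.
Proof.
move=> [[g fK gK] ef]; exists g; split; first by exists f.
by move=> x y; rewrite -ef !gK.
Qed.

(** * Maps that are multiplicative on a subgroup *)

Section SubgroupMorphisms.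
Variables G G' : groupType.
Local Open Scope group_scope.

Lemma subgroupT : is_subgroup [set: G].
Proof. by split=> [|x y _ _]; exact/mem_set. Qed.

Lemma subgroupX (K : set G) x n : is_subgroup K -> x \in K -> x ^+ n \in K.
Proof.
move=> Kgrp Kx; have [K1 _] := Kgrp.
by elim: n => // n IH; rewrite expgS (group_closedM Kgrp).
Qed.

Section In.
Variables (K : set G) (f : G -> G').
Hypotheses (Kgrp : is_subgroup K) (fM : {in K &, {morph f : x y / x * y}}).

Lemma morph_in1 : f 1 = 1.
Proof. by have [K1 _] := Kgrp; apply: (mulgI (f 1)); rewrite -fM // !mulg1. Qed.

Lemma morph_inV x : x \in K -> f x^-1 = (f x)^-1.
Proof.
move=> Kx; apply: (mulgI (f x)).
by rewrite -fM ?(group_closedV Kgrp) // !mulgV morph_in1.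
Qed.

Lemma morph_inX x n : x \in K -> f (x ^+ n) = f x ^+ n.
Proof.
move=> Kx; elim: n => [|n IH]; first exact: morph_in1.
by rewrite !expgS fM ?IH ?subgroupX.
Qed.

End In.

Lemma morph1 (f : G -> G') : {morph f : x y / x * y} -> f 1 = 1.
Proof. by move=> fM; apply: (morph_in1 subgroupT) => x y _ _. Qed.

Lemma morphV (f : G -> G') : {morph f : x y / x * y} -> {morph f : x / x^-1}.
Proof.
by move=> fM x; apply: (morph_inV subgroupT) => [y z _ _|]; last exact/mem_set.
Qed.

End SubgroupMorphisms.

(** * Cayley graphs: connectedness and the action by left translations *)

Section CayleyGraphs.
Variables (G : groupType) (S : seq G).
Local Open Scope group_scope.

Lemma cayley_mul (g x y : G) : cayley S (g * x) (g * y) = cayley S x y.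
Proof. by rewrite /cayley !invgM !mulgA !(mulgKA, mulgVK). Qed.

Lemma cayley_sym : symmetric (cayley S).
Proof. by move=> x y; rewrite /cayley orbC. Qed.

Lemma graph_iso_mul (g : G) : graph_iso (cayley S) (cayley S) (mulg g).
Proof.
split=> [|x y]; last by rewrite cayley_mul.
by exists (mulg g^-1); [exact: mulKg | exact: mulVKg].
Qed.

(** The elements reachable from 1 form a subgroup containing [S], because left translations preserve
    the graph. *)
Lemma generates_connected : generates S -> connected_graph (cayley S).
Proof.
move=> genS; pose R x y := exists k, walk_length (cayley S) x y k.
have R_sym x y : R x y -> R y x.
  by case=> k /(walk_sym cayley_sym); exists k.
have R_trans x y z : R x y -> R y z -> R x z.
  move=> [_ [p [ep <- _]]] [_ [q [eq <- _]]]; exists (size (p ++ q)), (p ++ q).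
  by rewrite cat_path ep last_cat.
have R_mul g x y : R x y -> R (g * x) (g * y).
  by case=> k /(graph_iso_walk _ _ _ (graph_iso_mul g)); exists k.
have R1 g : R 1 g.
  suff : [set g | R 1 g] = setT by move=> RT; have : setT g by []; rewrite -RT.
  apply: genS => [|s sS]; last first.
    by apply/mem_set; exists 1%N, [:: s]; rewrite /= /cayley invg1 mul1g sS.
  split; first by apply/mem_set; exists 0%N, [::].
  move=> x y /set_mem Rx /set_mem Ry; apply/mem_set; apply: R_trans Rx _.
  by apply: R_sym; rewrite -{2}(mulgVK y x) -{1}[x * y^-1]mulg1; apply: R_mul.
by move=> x y; apply: R_trans (R1 y); apply: R_sym.
Qed.

(** A walk from 1 never leaves a subgroup containing [S]. Generation thus becomes a property of the
    graph, which passes along graph isomorphisms. *)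
Lemma connected_generates : connected_graph (cayley S) -> generates S.
Proof.
move=> conS H Hgrp SH; have [H1 _] := Hgrp.
have [HV HM] := (group_closedV Hgrp, group_closedM Hgrp).
apply/seteqP; split=> // g _; apply/set_mem.
have [k [p [ep <- _]]] := conS 1 g; elim: p {k g} 1 H1 ep => [|y p IH] x Hx //=.
case/andP=> xy; apply: IH; case/orP: xy => /SH.
  by move=> /(HM _ _ Hx); rewrite mulVKg.
by move/HV => /(HM _ _ Hx); rewrite invgM invgK mulVKg.
Qed.

End CayleyGraphs.

Section CayleyAction.
Variables (G : groupType) (S : seq G) (V : choiceType) (e : rel V) (phi : G -> V).
Hypothesis phi_iso : graph_iso (cayley S) e phi.
Local Open Scope group_scope.

Lemma cayley_action : exists rho : G -> graph_aut e,
  [/\ {morph rho : x y / x * y}, injective rho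
    & forall g x, rho g (phi x) = phi (g * x)].
Proof.
have [[psi phiK psiK] ephi] := phi_iso.
have rhoP g : is_graph_aut e (phi \o mulg g \o psi).
  apply/asboolP; split.
    by exists (phi \o mulg g^-1 \o psi) => x /=; rewrite phiK (mulKg, mulVKg).
  by move=> x y /=; rewrite ephi cayley_mul -ephi !psiK.
pose rho g : graph_aut e := Sub _ (rhoP g).
have rhoE g x : rho g (phi x) = phi (g * x).
  by rewrite /rho /aut_fun SubK /= phiK.
exists rho; split=> // [g h | g h gh].
  by apply: graph_autP => x; rewrite -(psiK x) rhoE -mulgA -!rhoE.
by apply: (mulIg 1); apply: (can_inj phiK); rewrite -!rhoE gh.
Qed.

End CayleyAction.

(** * Finitely supported functions *)

Section FiniteSupport.
Variables (K : choiceType) (T : eqType) (d : T).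

Definition fsfun_of (g : K -> T) : {fsfun K -> T with d} :=
  [fsfun i in fset_set [set i | g i != d] => g i].

Lemma fsfun_ofE (g : K -> T) :
  finite_set [set i | g i != d] -> fsfun_of g =1 g.
Proof.
move=> fin_g i; rewrite fsfun_fun in_fset_set //; case: ifPn => //.
by rewrite notin_setE /= => /negP; rewrite negbK => /eqP.
Qed.

Lemma finite_support (f : {fsfun K -> T with d}) : finite_set [set i | f i != d].
Proof.
by apply: (sub_finite_set _ (finite_fset (finsupp f))) => i /=; rewrite mem_finsupp.
Qed.

Definition single (k : K) (u : T) : {fsfun K -> T with d} :=
  fsfun_of (fun i => if i == k then u else d).

Lemma singleE k u i : single k u i = if i == k then u else d.
Proof.
rewrite fsfun_ofE //; apply: (sub_finite_set _ (finite_set1 k)) => j /=.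
by case: (j =P k) => //; rewrite eqxx.
Qed.

End FiniteSupport.

(** * The Cayley graph of the lamplighter group *)

Section LamplighterCayley.
Variable F : finGroupType.
Local Open Scope ring_scope.

Implicit Types x y : lamplighter F.

Lemma lampM x y i : (x * y)%g.1 i = (x.1 i * y.1 (i - x.2))%g.
Proof. exact: lamp_mulE. Qed.

Lemma lampM2 x y : (x * y)%g.2 = x.2 + y.2.
Proof. by []. Qed.

Definition lamp_gen (u : F) : lamplighter F := (single 1%g 0 u, 1).

Definition lamp_gens : seq (lamplighter F) := [seq lamp_gen u | u : F].

Lemma mem_lamp_gens x y :
  reflect (exists u, y = (x * lamp_gen u)%g) ((x^-1 * y)%g \in lamp_gens).
Proof.
apply: (iffP mapP) => [[u _ xy]|[u ->]]; exists u.
- by rewrite -xy mulVKg.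
- by rewrite mem_enum.
- by rewrite mulKg.
Qed.

Lemma lamp_gens_generate : generates lamp_gens.
Proof.
move=> H Hgrp SH; have [H1 _] := Hgrp.
have [HV HM] := (group_closedV Hgrp, group_closedM Hgrp).
have Hgen u : lamp_gen u \in H by apply: SH; apply: map_f; rewrite mem_enum.
pose t (k : int) : lamplighter F := ([fsfun], k).
pose b (c : {fsfun int -> F with 1%g}) : lamplighter F := (c, 0).
have tD (k l : int) : t (k + l) = (t k * t l)%g.
  by apply: lampP => // i; rewrite lampM !fsfun0E mulg1.
have tV (k : int) : (t k)^-1%g = t (- k).
  by apply: (mulgI (t k)); rewrite mulgV -tD subrr.
have Ht1 : t 1 \in H.
  suff -> : t 1 = lamp_gen 1%g by [].
  by apply: lampP => // i; rewrite singleE fsfun0E if_same.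
have Ht (k : int) : t k \in H.
  elim/int_ind: k => [|k IH|k IH]; first exact: H1.
    by rewrite intS tD HM.
  by rewrite intS opprD tD HM // -tV HV.
have Hsingle k u : b (single 1%g k u) \in H.
  (* The extra [- 1] undoes the step up contained in the generator. *)
  have -> : b (single 1%g k u) = (t k * lamp_gen u * t (- k - 1))%g.
    apply: lampP => [i|]; last by rewrite /=; lia.
    by rewrite !lampM !fsfun0E mul1g mulg1 !singleE subr_eq0.
  by rewrite !HM.
have Hbase (s : seq int) (c : {fsfun int -> F with 1%g}) :
    {subset finsupp c <= s} -> b c \in H.
  elim: s c => [|k s IH] c cs.
    suff -> : b c = 1%g by [].
    apply: lampP => // i; rewrite lamp_oneE fsfun_dflt //.
    by apply/negP => /cs.
  pose c' := fsfun_of 1%g (fun i => if i == k then 1%g else c i).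
  have c'E i : c' i = if i == k then 1%g else c i.
    rewrite fsfun_ofE //; apply: (sub_finite_set _ (finite_support c)) => j /=.
    by case: (j =P k) => //; rewrite eqxx.
  have -> : b c = (b (single 1%g k (c k)) * b c')%g :> lamplighter F.
    apply: lampP => [i|] //.
    by rewrite lampM singleE subr0 c'E; case: eqP => [->|_]; rewrite (mulg1, mul1g).
  apply: HM => //; apply: IH => i; rewrite mem_finsupp c'E.
  case: (eqVneq i k) => [_|ik]; first by rewrite eqxx.
  by rewrite -mem_finsupp => /cs; rewrite inE (negPf ik).
apply/seteqP; split=> // -[c k] _; apply/set_mem.
have -> : (c, k) = (b c * t k)%g :> lamplighter F.
  by apply: lampP => [i|]; rewrite ?lampM ?lampM2 ?fsfun0E ?mulg1 ?add0r.
by apply: HM => //; apply: (Hbase (finsupp c)).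
Qed.

(** The edges oriented by increasing cursor. Only equality of lamps enters, not the product of [F],
    so groups with different lamp groups can be compared through this relation. *)
Definition lamp_up x y : bool :=
  `[< y.2 = x.2 + 1 /\ forall i : int, i != x.2 -> x.1 i = y.1 i >].

Lemma lamp_cayleyE x y : cayley lamp_gens x y = lamp_up x y || lamp_up y x.
Proof.
suff upE u v : ((u^-1 * v)%g \in lamp_gens) = lamp_up u v by rewrite /cayley !upE.
apply/mem_lamp_gens/asboolP => [[a ->]|[uv2 uv1]].
  split=> // i iu; rewrite lampM singleE subr_eq0 (negPf iu).
  by rewrite mulg1.
exists ((u.1 u.2)^-1 * v.1 u.2)%g; apply: lampP => // i.
rewrite lampM singleE subr_eq0; case: eqVneq => [->|/uv1 ->]; last by rewrite mulg1.
by rewrite mulVKg.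
Qed.

End LamplighterCayley.

(** * Identification of this Cayley graph with [DL(n, n)] *)

Section DiestelLeaderLamplighter.
Variable n : nat.
Local Open Scope ring_scope.

Notation L := (lamplighter 'Z_n).
Implicit Types x y : L.

(* The lamps below the cursor are read downwards by the first tree and those
   from the cursor on are read upwards by the second one, so that moving the
   cursor past a lamp forgets it on one side and appends it on the other. *)
Definition DL_left x : tree n :=
  (x.2, fsfun_of 0 (fun j : nat => x.1 (x.2 - 1 - j%:Z) : 'Z_n)).

Definition DL_right x : tree n :=
  (- x.2, fsfun_of 0 (fun j : nat => x.1 (x.2 + j%:Z) : 'Z_n)).

Lemma DL_leftE x j : (DL_left x).2 j = x.1 (x.2 - 1 - j%:Z).
Proof.
rewrite fsfun_ofE //; have := finite_support x.1.
by apply: finite_preimage => i k _ _; lia.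
Qed.

Lemma DL_rightE x j : (DL_right x).2 j = x.1 (x.2 + j%:Z).
Proof.
rewrite fsfun_ofE //; have := finite_support x.1.
by apply: finite_preimage => i k _ _; lia.
Qed.

Fact DL_of_lamp_subproof x :
  busemann (DL_left x, DL_right x).1 + busemann (DL_left x, DL_right x).2 == 0.
Proof. by rewrite !busemann_height /= subrr. Qed.

Definition DL_of_lamp x : DL_vertex n :=
  Sub (DL_left x, DL_right x) (DL_of_lamp_subproof x).

(** The first equation compares the lamps below position [x.2], the second those above it; the lamp
    at [x.2] enters neither. *)
Lemma DL_of_lamp_up x y :
  ((DL_left x == parent (DL_left y)) && (DL_right y == parent (DL_right x)))
  = lamp_up x y.
Proof.
apply/andP/asboolP => [[/eqP xy /eqP yx]|[xy2 xy1]].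
  have k_xy : x.2 = y.2 - 1 := congr1 fst xy.
  split=> [|i ix]; first by lia.
  case: (ltrP i x.2) => [i_lt|i_ge].
    have : (DL_left x).2 (absz (x.2 - 1 - i)%R) =
        (parent (DL_left y)).2 (absz (x.2 - 1 - i)%R).
      by rewrite xy.
    rewrite parentE !DL_leftE.
    have -> : x.2 - 1 - (absz (x.2 - 1 - i)%R)%:Z = i by lia.
    by have -> : y.2 - 1 - (absz (x.2 - 1 - i)%R).+1%:Z = i by lia.
  have : (DL_right y).2 (absz (i - y.2)%R) =
      (parent (DL_right x)).2 (absz (i - y.2)%R).
    by rewrite yx.
  rewrite parentE !DL_rightE.
  have -> : y.2 + (absz (i - y.2)%R)%:Z = i by lia.
    by have -> : x.2 + (absz (i - y.2)%R).+1%:Z = i by lia.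
split; apply/eqP/treeP => [|j]; first by rewrite /= xy2; lia.
- rewrite parentE !DL_leftE xy1; last by lia.
  by rewrite xy2; congr (_ _); lia.
- by rewrite /= xy2; lia.
- rewrite parentE !DL_rightE -xy1; last by lia.
  by rewrite xy2; congr (_ _); lia.
Qed.

Lemma DL_of_lamp_iso :
  graph_iso (cayley (lamp_gens 'Z_n)) (@DL_adj n) DL_of_lamp.
Proof.
split=> [|x y]; last first.
  rewrite lamp_cayleyE -!DL_of_lamp_up /DL_adj SubK /= /tree_adj.
  have height (u v : tree n) : u == parent v -> u.1 = v.1 - 1 by move/eqP=> ->.
  apply/andP/orP => [[]|[]/andP[-> ->]]; rewrite ?orbT //.
  (* The heights in the two trees are opposite, so one coordinate moves to its parent exactly when
     the other moves to a child; the two remaining cases are absurd. *)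
  move=> /orP[/[dup]/height/= h1 ->|/[dup]/height/= h1 ->];
  move=> /orP[/[dup]/height/= h2 ->|/[dup]/height/= h2 ->]; rewrite ?andbT; auto;
    lia.
(* The inverse map reads the lamps below the cursor from the first word and the others from the
   second. *)
pose c (p : tree n * tree n) (i : int) : 'Z_n :=
  if i < p.1.1 then p.1.2 (absz (p.1.1 - 1 - i)%R) else p.2.2 (absz (i - p.1.1)%R).
have cE p : fsfun_of 1%g (c p) =1 c p.
  apply: fsfun_ofE; apply: (@sub_finite_set _ _
    ([set p.1.1 - 1 - j%:Z | j in [set j : nat | p.1.2 j != 0]]
     `|` [set p.1.1 + j%:Z | j in [set j : nat | p.2.2 j != 0]])); last first.
    by rewrite finite_setU; split; apply: finite_image; apply: finite_support.
  move=> i /=; rewrite /c; case: ltrP => i_p ci; [left|right].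
    by exists (absz (p.1.1 - 1 - i)%R) => //; lia.
  by exists (absz (i - p.1.1)%R) => //; lia.
exists (fun p : DL_vertex n => (fsfun_of 1%g (c (val p)), (val p).1.1) : L).
  move=> x; apply: lampP => [i|] //; rewrite cE SubK /c /=.
  by case: ltrP => i_x; rewrite (DL_leftE, DL_rightE); congr (_ _); lia.
move=> p; apply/val_inj; rewrite SubK; case: p => -[u v] /= uv.
have uv0 : v.1 = - u.1 by move: uv; rewrite !busemann_height /=; lia.
congr pair; apply: treeP => [|j]; rewrite ?DL_leftE ?DL_rightE ?cE /c //=.
  by rewrite ifT; [congr (_ _); lia|lia].
by rewrite ifF; [congr (_ _); lia|lia].
Qed.

End DiestelLeaderLamplighter.

(** * Finite sums over F_2 and the bilinear form of the crossing *)

Section EventuallyZeroSums.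
Implicit Types (h : nat -> bool) (v w : int -> bool).
Local Open Scope ring_scope.

(* The sum of [h] over F_2, meaningful only if [h] has finite support. *)
Definition parity h : bool :=
  \big[addb/false]_(s < xget 0%N [set N | forall s, (N <= s)%N -> h s = false]) h s.

(** Only zeros lie between two admissible bounds, so the one picked by [xget] is immaterial. *)
Lemma parityE N h : (forall s, (N <= s)%N -> h s = false) ->
  parity h = \big[addb/false]_(s < N) h s.
Proof.
rewrite /parity; case: xgetP => [M _ hM hN | /(_ N)/= //].
have widen K L : (K <= L)%N -> (forall s, (K <= s)%N -> h s = false) ->
    \big[addb/false]_(s < K) h s = \big[addb/false]_(s < L) h s.
  move=> KL hK; rewrite -!(big_mkord xpredT) [RHS](big_cat_nat _ KL) //=.
  rewrite big_nat_cond [X in _ (+) X]big_nat_cond [X in _ (+) X]big1.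
    by rewrite addbF -big_nat_cond.
  by move=> s /andP[/andP[/hK]].
by case/orP: (leq_total M N) => /widen ->.
Qed.

Lemma parity_add h h' N :
  (forall s, (N <= s)%N -> h s = false) -> (forall s, (N <= s)%N -> h' s = false) ->
  parity (fun s => h s (+) h' s) = parity h (+) parity h'.
Proof.
move=> hN h'N; rewrite !(@parityE N) ?big_split // => s Ns.
by rewrite hN ?h'N.
Qed.

Lemma parity_single h s0 : (forall s, s != s0 -> h s = false) -> parity h = h s0.
Proof.
move=> hs0; rewrite (@parityE s0.+1) => [|s s0s]; last by apply: hs0; lia.
by rewrite big_ord_recr /= big1 // => i _; apply: hs0; rewrite ltn_eqF.
Qed.

Lemma parity0 h : (forall s, h s = false) -> parity h = false.
Proof. by move=> h0; rewrite (@parity_single _ 0%N). Qed.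

Definition bounded (T : Type) (d : T) (f : int -> T) : Prop :=
  exists N, forall i : int, (N <= absz i)%N -> f i = d.

Lemma bounded_finite_support (T : eqType) (d : T) (f : int -> T) :
  bounded d f -> finite_set [set i | f i != d].
Proof.
move=> [N fN]; apply: (@sub_finite_set _ _ [set j%:Z - N%:Z | j in `I_N.*2]).
  move=> i /= fi; have iN : (absz i < N)%N.
    by rewrite ltnNge; apply: contra fi => /fN ->.
  by exists (absz (i + N%:Z)) => /=; lia.
exact/finite_image/finite_II.
Qed.

Lemma bounded_fsfun (T : eqType) (d : T) (f : {fsfun int -> T with d}) :
  bounded d f.
Proof.
exists (\max_(i <- finsupp f) (absz i).+1) => i; rewrite leqNgt.
by case: (boolP (i \in finsupp f)) => [fi /negP[]|/fsfun_dflt //];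
  rewrite leq_bigmax_seq.
Qed.

Lemma bounded_shift (T : Type) (d : T) (f : int -> T) (k : int) :
  bounded d f -> bounded d (fun i => f (i - k)).
Proof. by move=> [N fN]; exists (N + absz k)%N => i iN; apply: fN; lia. Qed.

Lemma bounded_add v w : bounded false v -> bounded false w ->
  bounded false (fun i => v i (+) w i).
Proof. by move=> [M vM] [N wN]; exists (M + N)%N => i iN; rewrite vM ?wN //; lia. Qed.

(* The value at [m] of the F_2-bilinear form with x_i, x_j |-> z_((i + j) / 2)
   for i > j of the same parity, and 0 for all other pairs. *)
Definition wiring v w (m : int) : bool :=
  parity (fun s => v (m + s.+1%:Z) && w (m - s.+1%:Z)).

Lemma wiring_addl v v' w m : bounded false v -> bounded false v' ->
  wiring (fun i => v i (+) v' i) w m = wiring v w m (+) wiring v' w m.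
Proof.
move=> [M vM] [N vN]; rewrite /wiring -(@parity_add _ _ (M + N + absz m)%N).
- by congr parity; apply/funext => s; rewrite andb_addl.
- by move=> s sN; rewrite vM //; lia.
- by move=> s sN; rewrite vN //; lia.
Qed.

Lemma wiring_addr v w w' m : bounded false w -> bounded false w' ->
  wiring v (fun i => w i (+) w' i) m = wiring v w m (+) wiring v w' m.
Proof.
move=> [M vM] [N vN]; rewrite /wiring -(@parity_add _ _ (M + N + absz m)%N).
- by congr parity; apply/funext => s; rewrite andb_addr.
- by move=> s sN; rewrite vM ?andbF //; lia.
- by move=> s sN; rewrite vN ?andbF //; lia.
Qed.

Lemma wiring_shift v w k m :
  wiring (fun i => v (i - k)) (fun i => w (i - k)) m = wiring v w (m - k).
Proof.
by rewrite /wiring; congr parity; apply/funext => s; congr (v _ && w _); lia.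
Qed.

(** The only possible nonzero term is [s = m - k - 1], whose other factor sits at the mirror image
    [2m - k] of [k] in [m]. *)
Lemma wiring_singler v (a : bool) (k m : int) :
  wiring v (fun i => (i == k) && a) m = [&& k < m, v (m + m - k) & a].
Proof.
case: (ltrP k m) => km; last first.
  by apply: parity0 => s; rewrite (_ : _ == k = false) ?andbF //; lia.
rewrite /wiring (@parity_single _ (absz (m - k)).-1) => [|s sk].
  by rewrite (_ : _ == k) /=; [congr (v _ && _); lia | lia].
by rewrite (_ : _ == k = false) ?andbF //; lia.
Qed.

Lemma wiring_singlel w (a : bool) (k m : int) :
  wiring (fun i => (i == k) && a) w m = [&& m < k, w (m + m - k) & a].
Proof.
case: (ltrP m k) => km; last first.
  by apply: parity0 => s; rewrite (_ : _ == k = false) //; lia.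
rewrite /wiring (@parity_single _ (absz (m - k)).-1) => [|s sk].
  by rewrite (_ : _ == k) /= 1?andbC; [congr (w _ && _); lia | lia].
by rewrite (_ : _ == k = false) //; lia.
Qed.

(** One argument is always farther from 0 than [m]: [m + s + 1] if [m >= 0], and [m - s - 1] if
    [m < 0]. *)
Lemma bounded_wiring v w : bounded false v -> bounded false w ->
  bounded false (wiring v w).
Proof.
move=> [M vM] [N wN]; exists (M + N)%N => m mN; apply: parity0 => s.
by case: (lerP 0 m) => m0; [rewrite vM //|rewrite wN ?andbF //]; lia.
Qed.

Lemma bounded_delta (k : int) (a : bool) : bounded false (fun i => (i == k) && a).
Proof. by exists (absz k).+1 => i ik; rewrite (_ : i == k = false) //; lia. Qed.

Lemma wiring0l w m : wiring (fun=> false) w m = false.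
Proof. by apply: parity0. Qed.

Lemma wiring0r v m : wiring v (fun=> false) m = false.
Proof. by apply: parity0 => s; rewrite andbF. Qed.

End EventuallyZeroSums.

(** * The crosswired group and its Cayley graph *)

Section CrossWiredLamplighter.
Local Open Scope ring_scope.

(* A central extension, with cocycle [wiring], of the finitely supported
   sequences [vlamp] by the finitely supported sequences [zlamp], extended by
   the shift. *)
Definition crosswired : Type :=
  ({fsfun int -> (bool * bool)%type with (false, false)} * int)%type.
HB.instance Definition _ := Choice.copy crosswired
  ({fsfun int -> (bool * bool)%type with (false, false)} * int)%type.

Implicit Types x y : crosswired.

Definition vlamp x (i : int) : bool := (x.1 i).1.
Definition zlamp x (i : int) : bool := (x.1 i).2.

Lemma bounded_vlamp x : bounded false (vlamp x).
Proof.
by have [N xN] := bounded_fsfun x.1; exists N => i /xN; rewrite /vlamp => ->.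
Qed.

Lemma bounded_zlamp x : bounded false (zlamp x).
Proof.
by have [N xN] := bounded_fsfun x.1; exists N => i /xN; rewrite /zlamp => ->.
Qed.

Lemma crosswiredP x y :
  vlamp x =1 vlamp y -> zlamp x =1 zlamp y -> x.2 = y.2 -> x = y.
Proof.
move=> vxy zxy xy; rewrite [x]surjective_pairing [y]surjective_pairing xy.
congr pair; apply/fsfunP => i; have := vxy i; have := zxy i; rewrite /vlamp /zlamp.
by case: (x.1 i) (y.1 i) => [? ?] [? ?] /= -> ->.
Qed.

Definition mk_crosswired (v z : int -> bool) (k : int) : crosswired :=
  (fsfun_of (false, false) (fun i => (v i, z i)), k).

Lemma mk_crosswiredE v z k i : bounded false v -> bounded false z ->
  (mk_crosswired v z k).1 i = (v i, z i).
Proof.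
move=> [M vM] [N zN]; rewrite fsfun_ofE //; apply: bounded_finite_support.
by exists (M + N)%N => j jN; rewrite vM ?zN //; lia.
Qed.

Lemma vlampE v z k : bounded false v -> bounded false z ->
  vlamp (mk_crosswired v z k) = v.
Proof. by move=> bv bz; apply/funext => i; rewrite /vlamp mk_crosswiredE. Qed.

Lemma zlampE v z k : bounded false v -> bounded false z ->
  zlamp (mk_crosswired v z k) = z.
Proof. by move=> bv bz; apply/funext => i; rewrite /zlamp mk_crosswiredE. Qed.

Definition cw_mul x y : crosswired :=
  let w i := vlamp y (i - x.2) in
  mk_crosswired (fun i => vlamp x i (+) w i)
    (fun i => zlamp x i (+) zlamp y (i - x.2) (+) wiring (vlamp x) w i)
    (x.2 + y.2).

Definition cw_one : crosswired := ([fsfun], 0).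

(** As [v + v = 0], the inverse of [(v, z)] in the base is [(v, z + wiring v v)]; it is then
    translated by [- x.2]. *)
Definition cw_inv x : crosswired :=
  mk_crosswired (fun i => vlamp x (i + x.2))
    (fun i => zlamp x (i + x.2) (+) wiring (vlamp x) (vlamp x) (i + x.2)) (- x.2).

Hint Resolve bounded_vlamp bounded_zlamp bounded_add bounded_shift bounded_wiring
  : core.

Lemma bounded_shiftN (T : Type) (d : T) (f : int -> T) (k : int) :
  bounded d f -> bounded d (fun i => f (i + k)).
Proof. by move=> /(bounded_shift (- k)); rewrite opprK. Qed.

Hint Resolve bounded_shiftN : core.

Lemma vlampM x y : vlamp (cw_mul x y) = fun i => vlamp x i (+) vlamp y (i - x.2).
Proof. by rewrite vlampE //; auto 10. Qed.

Lemma zlampM x y : zlamp (cw_mul x y) = fun i =>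
  zlamp x i (+) zlamp y (i - x.2)
    (+) wiring (vlamp x) (fun i => vlamp y (i - x.2)) i.
Proof. by rewrite zlampE //; auto 10. Qed.

Lemma vlamp1 : vlamp cw_one = fun=> false.
Proof. by apply/funext => i; rewrite /vlamp fsfun0E. Qed.

Lemma zlamp1 : zlamp cw_one = fun=> false.
Proof. by apply/funext => i; rewrite /zlamp fsfun0E. Qed.

Lemma vlampV x : vlamp (cw_inv x) = fun i => vlamp x (i + x.2).
Proof. by rewrite vlampE //; auto 10. Qed.

Lemma zlampV x : zlamp (cw_inv x) = fun i =>
  zlamp x (i + x.2) (+) wiring (vlamp x) (vlamp x) (i + x.2).
Proof. by rewrite zlampE //; auto 10. Qed.

(** Bilinearity makes [wiring] a 2-cocycle, and its invariance under translation lets the shift act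
    by automorphisms. *)
Fact cw_mulA : associative cw_mul.
Proof.
move=> x y u; apply: crosswiredP => [i|i|]; last exact: addrA.
  by rewrite !vlampM opprD !addrA addbA.
have subD : (fun i => vlamp u (i - (x.2 + y.2))) =
    (fun i => vlamp u (i - x.2 - y.2)).
  by apply/funext => j; rewrite opprD addrA.
rewrite !(zlampM, vlampM) /= subD opprD addrA.
rewrite wiring_addl ?wiring_addr; auto; last first.
  exact: (bounded_shift x.2 (bounded_shift y.2 (bounded_vlamp u))).
rewrite (wiring_shift (vlamp y) (fun i => vlamp u (i - y.2)) x.2).
case: (wiring (vlamp y) _ _);
case: (wiring (vlamp x) (fun i => vlamp y (i - x.2)) _);
case: (wiring (vlamp x) _ _);
by case: (zlamp x _); case: (zlamp y _); case: (zlamp u _).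
Qed.

Fact cw_mul1 : left_id cw_one cw_mul.
Proof.
move=> x; apply: crosswiredP => [i|i|]; last exact: add0r.
  by rewrite vlampM vlamp1 subr0.
by rewrite zlampM zlamp1 vlamp1 wiring0l subr0 addbF.
Qed.
Fact cw_1mul : right_id cw_one cw_mul.
Proof.
move=> x; apply: crosswiredP => [i|i|]; last exact: addr0.
  by rewrite vlampM vlamp1 addbF.
by rewrite zlampM zlamp1 vlamp1 wiring0r !addbF.
Qed.
Fact cw_mulV : left_inverse cw_one cw_inv cw_mul.
Proof.
move=> x; apply: crosswiredP => [i|i|]; last exact: addNr.
  by rewrite vlampM vlampV vlamp1 opprK addbb.
rewrite zlampM zlampV vlampV zlamp1 opprK.
have -> : (fun i => vlamp x (i + x.2)) = (fun i => vlamp x (i - - x.2)).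
  by apply/funext => j; rewrite opprK.
by rewrite wiring_shift opprK; case: (zlamp _ _); case: (wiring _ _ _).
Qed.
Fact cw_Vmul : right_inverse cw_one cw_inv cw_mul.
Proof.
move=> x; apply: crosswiredP => [i|i|]; last exact: addrN.
  by rewrite vlampM vlampV vlamp1 subrK addbb.
rewrite zlampM zlampV vlampV zlamp1 subrK.
have -> : (fun i => vlamp x (i - x.2 + x.2)) = vlamp x.
  by apply/funext => j; rewrite subrK.
by case: (zlamp _ _); case: (wiring _ _ _).
Qed.

HB.instance Definition _ :=
  isGroup.Build crosswired cw_mulA cw_mul1 cw_1mul cw_mulV cw_Vmul.

(** A bijection of sets, not a homomorphism from (Z/2)^2. It sends the trivial lamp to 0, so
    supports stay finite. *)
Definition encode (p : bool * bool) : 'Z_4 := inZp (p.1.*2 + p.2).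
Definition decode (u : 'Z_4) : bool * bool := ((1 < u)%N, odd u).

Lemma encodeK : cancel encode decode.
Proof. by case=> [[] []]. Qed.

Lemma decodeK : cancel decode encode.
Proof. by case=> [[|[|[|[|//]]]] ?]; apply/val_inj. Qed.

Definition cw_gen (p : bool * bool) : crosswired := (single (false, false) 0 p, 1).

Definition cw_gens : seq crosswired := [seq cw_gen p | p : bool * bool].

Lemma mem_cw_gens x y :
  reflect (exists p, y = (x * cw_gen p)%g) ((x^-1 * y)%g \in cw_gens).
Proof.
apply: (iffP mapP) => [[p _ xy]|[p ->]]; exists p.
- by rewrite -xy mulVKg.
- by rewrite mem_enum.
- by rewrite mulKg.
Qed.

Lemma vlamp_gen p : vlamp (cw_gen p) = fun i => (i == 0) && p.1.
Proof. by apply/funext => i; rewrite /vlamp singleE; case: eqP. Qed.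

Lemma zlamp_gen p : zlamp (cw_gen p) = fun i => (i == 0) && p.2.
Proof. by apply/funext => i; rewrite /zlamp singleE; case: eqP. Qed.

Lemma vlampM_gen x p :
  vlamp (x * cw_gen p)%g = fun i => vlamp x i (+) ((i == x.2) && p.1).
Proof.
by rewrite vlampM vlamp_gen; apply/funext => i; rewrite subr_eq0.
Qed.

Lemma zlampM_gen x p : zlamp (x * cw_gen p)%g = fun i =>
  zlamp x i (+) ((i == x.2) && p.2) (+) [&& x.2 < i, vlamp x (i + i - x.2) & p.1].
Proof.
rewrite zlampM vlamp_gen zlamp_gen; apply/funext => i; rewrite subr_eq0.
rewrite -wiring_singler; congr (_ (+) wiring _ _ _); apply/funext => j.
by rewrite subr_eq0.
Qed.

(* A finite product of lamps taken in increasing order has coordinates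
   (vlamp, zlamp); taken in decreasing order, the second one is off by
   [wiring v v].  The two trees need increasing order below the cursor and
   decreasing order above it. *)
Definition unwire x (i : int) : 'Z_4 :=
  encode (vlamp x i, zlamp x i (+) ((x.2 <= i) && wiring (vlamp x) (vlamp x) i)).

Definition lamp_of_cw x : lamplighter 'Z_4 := (fsfun_of 1%g (unwire x), x.2).

Lemma lamp_of_cwE x : (lamp_of_cw x).1 =1 unwire x.
Proof.
apply: fsfun_ofE; apply: bounded_finite_support.
have [M xM] := bounded_vlamp x; have [N xN] := bounded_zlamp x.
have [P xP] := bounded_wiring (bounded_vlamp x) (bounded_vlamp x).
exists (M + N + P)%N => i iN; rewrite /unwire xM ?xN ?xP ?andbF; [|lia..].
exact: val_inj.
Qed.

(** The correction in [unwire] depends only on [vlamp] and the cursor, both readable from the image,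
    and adding it twice cancels. *)
Lemma lamp_of_cw_bij : bijective lamp_of_cw.
Proof.
pose v (c : lamplighter 'Z_4) i := (decode (c.1 i)).1.
pose z (c : lamplighter 'Z_4) i :=
  (decode (c.1 i)).2 (+) ((c.2 <= i) && wiring (v c) (v c) i).
have bv c : bounded false (v c).
  by have [N cN] := bounded_fsfun c.1; exists N => i /cN; rewrite /v => ->.
have bz c : bounded false (z c).
  have [N cN] := bounded_fsfun c.1; have [P cP] := bounded_wiring (bv c) (bv c).
  by exists (N + P)%N => i iN; rewrite /z cN ?cP ?andbF //; lia.
exists (fun c => mk_crosswired (v c) (z c) c.2) => [x|c].
  have vE : v (lamp_of_cw x) = vlamp x.
    by apply/funext => i; rewrite /v lamp_of_cwE encodeK.
  apply: crosswiredP => [i|i|] //; first by rewrite vlampE ?vE.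
  by rewrite zlampE // /z vE lamp_of_cwE encodeK /= addbK.
apply: lampP => [i|] //; rewrite lamp_of_cwE /unwire vlampE // zlampE // /z addbK.
by rewrite /v -surjective_pairing decodeK.
Qed.

(* Right multiplication by a generator changes [zlamp] at every i > x.2 with
   vlamp x (2 i - x.2) = 1, exactly as [wiring v v] does: the two cancel. *)
Lemma lamp_of_cw_up x y :
  ((x^-1 * y)%g \in cw_gens) = lamp_up (lamp_of_cw x) (lamp_of_cw y).
Proof.
have bounded_at := bounded_delta.
have up p : lamp_up (lamp_of_cw x) (lamp_of_cw (x * cw_gen p)%g).
  apply/asboolP; split; first by []; move=> i; rewrite !lamp_of_cwE /unwire /= => ix.
  rewrite zlampM_gen vlampM_gen wiring_addl ?wiring_addr //.
  rewrite !wiring_singler wiring_singlel (negPf ix) /= !addbF.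
  rewrite (_ : (i + i - x.2 == x.2) = false) /=; last by lia.
  rewrite andbF addbF lezD1.
  case: (ltrgtP x.2 i) ix => // _ _;
  by case: (zlamp x i); case: (vlamp x _ && _); case: wiring.
apply/idP/idP => [/mem_cw_gens[p ->]|/asboolP[/= xy2 xy1]]; first exact: up.
(* The generator is the difference of the lamps at [x.2]. After the move the cursor is above [x.2],
   so [unwire] makes no correction there. *)
apply/mem_cw_gens; exists (vlamp x x.2 (+) vlamp y x.2, zlamp x x.2 (+) zlamp y x.2).
set p := (X in cw_gen X); apply: (bij_inj lamp_of_cw_bij).
apply: lampP => [i|]; last exact: xy2.
have /asboolP[/= _ up1] := up p.
case: (eqVneq i x.2) => [->|ix]; last by rewrite -up1 ?xy1.
rewrite !lamp_of_cwE /unwire vlampM_gen zlampM_gen xy2 eqxx ltxx /=.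
rewrite (_ : (x.2 + 1 <= x.2) = false) ?addbF; last by lia.
by rewrite !addKb.
Qed.

Lemma lamp_of_cw_iso :
  graph_iso (cayley cw_gens) (cayley (lamp_gens 'Z_4)) lamp_of_cw.
Proof.
split=> [|x y]; first exact: lamp_of_cw_bij.
by rewrite lamp_cayleyE /cayley !lamp_of_cw_up.
Qed.

End CrossWiredLamplighter.

(** * Torsion and distant conjugates in lamplighter groups *)

Section FarConjugatesCommute.
Variable F : finGroupType.
Local Open Scope ring_scope.

Implicit Types x y a g : lamplighter F.

Lemma lampX2 x n : (x ^+ n)%g.2 = x.2 *+ n.
Proof. by elim: n => // n IH; rewrite expgS lampM2 IH mulrS. Qed.

(** With no shift, powers are taken lamp by lamp. *)
Lemma lamp_torsion x : x.2 = 0 -> (x ^+ #|F|)%g = 1%g.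
Proof.
move=> x0; have xX n i : (x ^+ n)%g.1 i = (x.1 i ^+ n)%g.
  elim: n => [|n IH]; first exact: lamp_oneE.
  by rewrite !expgS lampM x0 subr0 IH.
apply: lampP => [i|]; last by rewrite lampX2 x0 mul0rn.
by rewrite xX [RHS]lamp_oneE -cardsT; apply: expg_cardG; rewrite inE.
Qed.

(** Conjugation by [g ^+ j] displaces the support of [a] by [j * g.2]. If that support lies in
    [|i| < N], a displacement of at least [2N] makes the two supports disjoint. *)
Lemma lamp_far_conj_commute a g : a.2 = 0 -> g.2 != 0 ->
  exists J, forall j, (J <= j)%N -> commute a (g ^+ j * a * g ^- j)%g.
Proof.
move=> a0 g0; have [N aN] := bounded_fsfun a.1; exists N.*2 => j Jj.
set y := (g ^+ j)%g; have yN : (N.*2 <= absz y.2)%N.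
  rewrite /y lampX2 -mulr_natr natz abszM absz_nat.
  by rewrite (leq_trans Jj) // leq_pmull // absz_gt0.
set b := (y * a * y^-1)%g.
have b0 : b.2 = 0 by rewrite /b !lampM2 a0 addr0 /= subrr.
have b1 i : a.1 (i - y.2) = 1%g -> b.1 i = 1%g.
  move=> ai; rewrite /b !lampM ai mulg1 lampM2 a0 addr0.
  by rewrite [X in (_ * X)%g]lamp_invE subrK mulgV.
apply: lampP => [i|]; last by rewrite !lampM2 addrC.
rewrite [LHS]lampM [RHS]lampM a0 b0 subr0; have [Ni|iN] := leqP N (absz i).
  by rewrite aN // mulg1 mul1g.
by rewrite b1 ?mulg1 ?mul1g // aN //; lia.
Qed.

End FarConjugatesCommute.

(** * Cosets of a finite index subgroup *)

Section FiniteIndex.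
Variable G : groupType.
Local Open Scope group_scope.

(** Infinitely many indices share finitely many cosets, so two of the [h n] lie in the same one. *)
Lemma finite_index_pigeonhole (K H : set G) (h : nat -> G) :
  finite_index_subgroup K H -> (forall n, H (h n)) ->
  exists i j, (i < j)%N /\ K ((h i)^-1 * h j).
Proof.
move=> [[K1 _] _ finHK] Hh; pose u n : set G := [set h n * k | k in K].
suff [i [j [ij uij]]] : exists i j, (i < j)%N /\ u i = u j.
  exists i, j; split=> //; have : u j (h j).
    by exists 1; [exact: set_mem | rewrite mulg1].
  by rewrite -uij => -[k Kk <-]; rewrite mulKg.
apply: contrapT => nu; apply: infinite_nat.
apply: (@sub_finite_set _ _ (u @^-1` [set [set x * k | k in K] | x in H])).
  by move=> n _; exists (h n).
apply: finite_preimage => // i j _ _ uij; apply: contrapT => /eqP.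
by rewrite neq_ltn => /orP[] ?; apply: nu; [exists i, j|exists j, i].
Qed.

End FiniteIndex.

(** * Finite index subgroups of the crosswired group do not embed in lamplighter groups *)

Section NoEmbedding.
Variable F : finGroupType.
Local Open Scope ring_scope.

Definition cw_shift (k : int) : crosswired := ([fsfun], k).

Definition xlamp (p : int) : crosswired :=
  (single (false, false) p (true, false), 0).

Lemma vlamp_shift k : vlamp (cw_shift k) = fun=> false.
Proof. by apply/funext => i; rewrite /vlamp fsfun0E. Qed.

Lemma zlamp_shift k : zlamp (cw_shift k) = fun=> false.
Proof. by apply/funext => i; rewrite /zlamp fsfun0E. Qed.

Lemma vlamp_xlamp p i : vlamp (xlamp p) i = (i == p).
Proof. by rewrite /vlamp singleE; case: eqP. Qed.

Lemma cw_shiftD k l : cw_shift (k + l) = (cw_shift k * cw_shift l)%g.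
Proof.
apply: crosswiredP => [i|i|] //.
  by rewrite vlampM !vlamp_shift.
by rewrite zlampM !zlamp_shift !vlamp_shift wiring0l.
Qed.

Lemma cw_shiftX k n : (cw_shift k ^+ n)%g = cw_shift (k *+ n).
Proof. by elim: n => // n IH; rewrite expgS IH mulrS cw_shiftD. Qed.

Lemma cw_shiftV k : (cw_shift k)^-1%g = cw_shift (- k).
Proof. by apply: (mulgI (cw_shift k)); rewrite mulgV -cw_shiftD subrr. Qed.

(** The square has trivial [vlamp], hence lies in the elementary abelian 2-group of the z_i. *)
Lemma cw_torsion (a : crosswired) : a.2 = 0 -> (a ^+ 4)%g = 1%g.
Proof.
move=> a0; rewrite (expgnA a 2 2) expg2.
have aa0 : (a ^+ 2)%g.2 = 0 by rewrite expg2 /= a0.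
have va0 : vlamp (a ^+ 2)%g = fun=> false.
  by rewrite expg2 vlampM a0; apply/funext => i; rewrite subr0 addbb.
apply: crosswiredP => [i|i|].
- by rewrite vlampM va0 [in RHS]vlamp1.
- by rewrite zlampM va0 aa0 subr0 wiring0l addbb [in RHS]zlamp1.
- by rewrite [LHS](_ : _ = (a ^+ 2)%g.2 + (a ^+ 2)%g.2) // aa0.
Qed.

(** The [zlamp] coordinates of the two products differ only by the order of the arguments of
    [wiring]. *)
Lemma cw_commute_wiring (a b : crosswired) : a.2 = 0 -> b.2 = 0 ->
  commute a b -> wiring (vlamp a) (vlamp b) =1 wiring (vlamp b) (vlamp a).
Proof.
move=> a0 b0 ab m; have := congr1 (fun x => zlamp x m) ab.
rewrite !zlampM a0 b0 subr0.
have sub0 (c : crosswired) : (fun i => vlamp c (i - 0)) = vlamp c.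
  by apply/funext => i; rewrite subr0.
rewrite !sub0 (addbC (zlamp b m)); exact: addbI.
Qed.

(* [K] contains a shift g and, by pigeonhole, some a = x_p^-1 x_q: the
   conjugates of a by high even powers of g never commute with a. *)
Lemma cw_finite_index_no_embedding (K : set crosswired)
    (f : crosswired -> lamplighter F) :
  finite_index_subgroup K setT -> {in K &, {morph f : x y / (x * y)%g}} ->
  {in K &, injective f} -> False.
Proof.
move=> KT fM f_inj; have [Kgrp _ _] := KT; have [K1 _] := Kgrp.
have [KV KM] := (group_closedV Kgrp, group_closedM Kgrp).
have f1 := morph_in1 Kgrp fM; have fV := morph_inV Kgrp fM.
have KX x n := @subgroupX _ K x n Kgrp; have fX := morph_inX Kgrp fM.
have [d d_gt0 Kg] : exists2 d : nat, (0 < d)%N & cw_shift d \in K.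
  have [i [j [ij Kij]]] :=
    @finite_index_pigeonhole _ _ _ (fun n : nat => cw_shift n) KT (fun=> I).
  exists (j - i)%N; first by rewrite subn_gt0.
  apply/mem_set; move: Kij; rewrite cw_shiftV -cw_shiftD.
  by congr (K (cw_shift _)); lia.
have [p [q [pq Kpq]]] : exists p q : nat,
    (p < q)%N /\ ((xlamp p)^-1 * xlamp q)%g \in K.
  have [i [j [ij Kij]]] :=
    @finite_index_pigeonhole _ _ _ (fun n : nat => xlamp n) KT (fun=> I).
  by exists i, j; split=> //; exact/mem_set.
have [a Ka [a0 va]] : exists2 a, a \in K
    & a.2 = 0 /\ forall i, vlamp a i = (i == p%:Z) (+) (i == q%:Z).
  exists ((xlamp p)^-1 * xlamp q)%g => //; split=> // i.
  by rewrite vlampM vlampV !vlamp_xlamp /= !addr0.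
(* [f a] has finite order, and Z is torsion free. *)
have fa0 : (f a).2 = 0.
  have : (f a ^+ 4)%g.2 = 0 by rewrite -fX // cw_torsion // f1.
  by rewrite lampX2; lia.
pose g := cw_shift d.
(* Otherwise [f g] would be torsion, and injectivity would give the nontrivial shift [g] finite
   order. *)
have fg0 : (f g).2 != 0.
  apply/eqP => /lamp_torsion; rewrite -fX // -f1 => /f_inj.
  move=> /(_ (KX _ _ Kg) K1); rewrite cw_shiftX => /(congr1 snd) /= /eqP.
  rewrite mulrn_eq0 => /orP[/eqP F0|/eqP]; last by lia.
  by have := fintype0 (1%g : F) F0.
have [J Jcomm] := lamp_far_conj_commute fa0 fg0.
(* Conjugation by [g ^+ j] moves lamps by [d * j = 2r]: being even, this gives [p] and [p + 2r] the
   integer midpoint [p + r]. Moreover [j >= J] makes the images commute, and [r >= q] puts the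
   support of [b] above that of [a]. *)
pose r := (d * (J + q))%N; pose j := (J + q).*2.
have [y Ky [yE fy]] :
    exists2 y, y \in K & y = cw_shift (r + r)%:Z /\ f y = (f g ^+ j)%g.
  exists (g ^+ j)%g; first exact: KX.
  by split; [rewrite cw_shiftX -mulr_natr natz /r /j; congr cw_shift; nia | exact: fX].
have Kya : (y * a)%g \in K := KM _ _ Ky Ka.
pose b := (y * a * y^-1)%g; have Kb : b \in K := KM _ _ Kya (KV _ Ky).
have fb : f b = (f g ^+ j * f a * f g ^- j)%g.
  by rewrite /b (fM _ _ Kya (KV _ Ky)) (fM _ _ Ky Ka) (fV _ Ky) fy.
have ab : commute a b.
  apply: f_inj; [exact: KM | exact: KM | rewrite (fM _ _ Ka Kb) (fM _ _ Kb Ka) fb].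
  by apply: Jcomm; rewrite /j; lia.
have b0 : b.2 = 0 by rewrite /b yE /= a0 addr0 subrr.
have vb i : vlamp b i = (i == (p + r + r)%:Z) (+) (i == (q + r + r)%:Z).
  rewrite /b (vlampM (y * a)%g) (vlampM y a) yE cw_shiftV !vlamp_shift va addbF.
  by rewrite /=; congr (_ (+) _); apply/eqP/eqP; lia.
have r_ge : (q <= r)%N by rewrite /r; nia.
(* At [p + r] the only contribution pairs position [p + 2r] of [b] with position [p] of [a]. It
   counts only with [b] as first argument, so one side is 0 and the other 1. *)
have := cw_commute_wiring a0 b0 ab (p + r)%:Z.
have -> : vlamp a = fun i => ((i == p%:Z) && true) (+) ((i == q%:Z) && true).
  by apply/funext => i; rewrite va !andbT.
have -> : vlamp b = fun i =>
    ((i == (p + r + r)%:Z) && true) (+) ((i == (q + r + r)%:Z) && true).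
  by apply/funext => i; rewrite vb !andbT.
have bnd k := bounded_delta k true.
rewrite [LHS]wiring_addr // [RHS]wiring_addr // !wiring_singler !andbT.
by move: (r) pq r_ge; clear => r; lia.
Qed.

End NoEmbedding.

(** * From a Cayley graph to a lattice in the isometry group *)

Section CayleyLattice.
Variables (n : nat) (G : groupType) (S : seq G) (phi : G -> DL_vertex n).
Hypothesis phi_iso : graph_iso (cayley S) (@DL_adj n) phi.
Local Open Scope group_scope.

(** Left translations act simply transitively on the vertices: stabilizers are trivial and there is
    one orbit. *)
Lemma cayley_DL_lattice : exists2 rho : G -> IsomDL n,
  {morph rho : x y / x * y} /\ injective rho & cocompact_lattice (range rho).
Proof.
have [rho [rhoM rho_inj rhoE]] := cayley_action phi_iso.
have [[psi phiK psiK] _] := phi_iso.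
have rho1 := morph1 rhoM; have rhoV := morphV rhoM.
exists rho => //; split.
- split; first by apply/mem_set; exists 1.
  move=> _ _ /set_mem[g _ <-] /set_mem[h _ <-]; apply/mem_set.
  by exists (g * h^-1) => //; rewrite rhoM rhoV.
- move=> u; apply: (sub_finite_set _ (finite_set1 (rho 1))) => _ [[g _ <-]].
  rewrite -(psiK u) rhoE => /(can_inj phiK) gu /=.
  by congr rho; apply: (mulIg (psi u)); rewrite mul1g.
- apply: (sub_finite_set _ (finite_set1 setT)) => _ [u _ <-] /=.
  apply/seteqP; split=> // v _; exists (rho (psi v * (psi u)^-1)).
    by exists (psi v * (psi u)^-1).
  by rewrite -{2}(psiK u) rhoE mulgVK psiK.
Qed.

End CayleyLattice.

(** * Transfer of finite index, and quasi-isometry from isomorphic Cayley graphs *)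

Section FiniteIndexTransport.
Variables G G' : groupType.
Local Open Scope group_scope.

(** Every coset of the preimage is the preimage of a coset of [Del]. *)
Lemma finite_index_preimage (rho : G -> G') (Del : set G') :
  {morph rho : x y / x * y} -> finite_index_subgroup Del (range rho) ->
  finite_index_subgroup (rho @^-1` Del) setT.
Proof.
move=> rhoM [[D1 DB] Drho finD].
have rho1 := morph1 rhoM; have rhoV := morphV rhoM.
split=> //.
  split; first by apply/mem_set; rewrite /= rho1; exact: set_mem.
  move=> x y /set_mem/mem_set Dx /set_mem/mem_set Dy; apply/mem_set.
  by rewrite /= rhoM rhoV; apply: set_mem; exact: DB.
apply: (sub_finite_set _ (finite_image (preimage rho) finD)) => _ [x _ <-].
exists [set rho x * k | k in Del]; first by exists (rho x) => //; exists x.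
apply/seteqP; split=> y /=; last first.
  by case=> k Dk <-; exists (rho k) => //; rewrite rhoM.
case=> k Dk kE; exists (x^-1 * y); last by rewrite mulVKg.
by rewrite /= rhoM rhoV -kE mulKg.
Qed.

Lemma finite_index_refl : finite_index_subgroup [set: G] [set: G].
Proof.
split=> //; first exact: subgroupT.
apply: (sub_finite_set _ (finite_set1 [set: G])) => _ [x _ <-] /=.
by apply/seteqP; split=> // y _; exists (x^-1 * y); rewrite ?mulVKg.
Qed.

Lemma commensurable_refl : commensurable G G.
Proof.
exists setT, setT; split; [exact: finite_index_refl | exact: finite_index_refl |].
by exists id; split=> //; split=> // x _; exists x.
Qed.

Lemma cayley_iso_quasi_isometric (S : seq G) (S' : seq G') (f : G -> G') :
  generates S -> generates S' -> graph_iso (cayley S) (cayley S') f ->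
  quasi_isometric G G'.
Proof.
move=> genS genS' fiso; exists S, S', f; split=> //.
exists 1%R, 0%R; split=> // [x y|y].
  by rewrite /word_metric (graph_iso_dist _ _ fiso) divr1 mul1r subr0 lexx.
have [[g fK gK] _] := fiso; exists (g y); rewrite gK /word_metric /dist.
case: pselect => [ex|//]; case: ex_minnP => m _ /(_ 0%N).
by rewrite leqn0 => /(_ _)/eqP ->; rewrite ?lexx //; apply/asboolP; exists [::].
Qed.

End FiniteIndexTransport.

(** * The lattice in [DL(4, 4)] and the quasi-isometric pair of groups *)

Lemma crosswired_generated : generates cw_gens.
Proof.
apply/connected_generates/(graph_iso_connected lamp_of_cw_iso).
exact/generates_connected/lamp_gens_generate.
Qed.

Theorem mainTheorem3 :
  (exists (n : nat) (Gam : set (IsomDL n)),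
     [/\ (2 <= n)%N, cocompact_lattice Gam
       & forall Del : set (IsomDL n), finite_index_subgroup Del Gam ->
         forall F : finGroupType,
           ~ isomorphic_subgroups Del [set: lamplighter F]])
  /\
  (exists G1 G2 : groupType,
     [/\ finitely_generated G1, finitely_generated G2, quasi_isometric G1 G2,
         exists F : finGroupType, commensurable G1 (lamplighter F)
       & forall F : finGroupType, ~ commensurable G2 (lamplighter F)]).
Proof.
have cw_DL := graph_iso_comp lamp_of_cw_iso (DL_of_lamp_iso 4).
split.
  have [rho [rhoM rho_inj] lat] := cayley_DL_lattice cw_DL.
  exists 4%N, (range rho); split=> // Del DelG F [f [fM [_ f_inj _]]].
  (* The preimage of [Del] under [rho] has finite index, and [f \o rho] would embed it in a
     lamplighter group. *)
  apply: (@cw_finite_index_no_embedding F _ (f \o rho)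
            (finite_index_preimage rhoM DelG)).
    move=> x y /set_mem Dx /set_mem Dy /=.
    by rewrite rhoM fM //; apply/mem_set.
  move=> x y /set_mem Dx /set_mem Dy /= fxy.
  by apply/rho_inj/f_inj => //; exact/mem_set.
have [f cw_iso] := graph_iso_inv lamp_of_cw_iso.
exists (lamplighter 'Z_4), crosswired; split.
- by exists (lamp_gens 'Z_4); exact: lamp_gens_generate.
- by exists cw_gens; exact: crosswired_generated.
- exact: (cayley_iso_quasi_isometric (@lamp_gens_generate 'Z_4)
           crosswired_generated cw_iso).
- by exists 'Z_4; exact: commensurable_refl.
- move=> F [H [K [HG _ [g [gM [_ g_inj _]]]]]].
  exact: (cw_finite_index_no_embedding HG gM g_inj).
Qed.
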